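(* Let $d,m\geq 2$ and $n\geq 1$ be integers, and let $\zeta\neq 1$ be a $d$-th root of unity. Then $G_{d,m,n}^{\zeta}$ is a monic polynomial in $\mathbb{Z}[\zeta][c]$, with only simple roots.
   Context: Let $f_{d,c}(z)=z^d+c$ and $a_i(c):=f_{d,c}^i(0)\in\mathbb{Z}[c]$. Define the rational function $G_{d,m,n}^{\zeta}(c):=\prod_{k\mid n}(a_{m+k-1}-\zeta a_{m-1})^{\mu(n/k)}\cdot \prod_{k\mid n}(a_k)^{-\mu(n/k)}$ if $n\mid m-1$, and $G_{d,m,n}^{\zeta}(c):=\prod_{k\mid n}(a_{m+k-1}-\zeta a_{m-1})^{\mu(n/k)}$ if $n\nmid m-1$, where $\mu$ is the Möbius function and products run over positive divisors $k$ of $n$. *)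

(* Defs.v *)
From HB Require Import structures.
From mathcomp Require Export all_boot all_order all_algebra all_field.

Set Implicit Arguments.
Unset Strict Implicit.
Unset Printing Implicit Defensive.

Import GRing.Theory.
Local Open Scope ring_scope.

Definition moebius (n : nat) : int :=
  if (0 < n)%N && all (fun p => logn p n == 1%N) (primes n)
  then (-1) ^+ size (primes n) else 0.

Definition unicritical (R : nzRingType) (d : nat) (c z : R) : R := z ^+ d + c.

(* The indeterminate 'X of {poly int} plays the role of the parameter c. *)
Definition crit_orbit (d i : nat) : {poly int} := iter i (unicritical d 'X) 0.

Definition crit_orbitC (d i : nat) : {poly algC} :=
  map_poly intr (crit_orbit d i).

(* For 2 <= d, 2 <= m and 0 < k all polynomials below are nonzero, so the
   negative integer powers are genuine inverses in the field algC(c). *)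
Definition misiurewicz_num (d m n : nat) (zeta : algC) :
    {fraction {poly algC}} :=
  \prod_(k <- divisors n)
    tofrac (crit_orbitC d (m + k - 1) - zeta *: crit_orbitC d (m - 1))
      ^ moebius (n %/ k).

Definition gleason_den (d n : nat) : {fraction {poly algC}} :=
  \prod_(k <- divisors n) tofrac (crit_orbitC d k) ^ (- moebius (n %/ k)).

Definition Gfun (d m n : nat) (zeta : algC) : {fraction {poly algC}} :=
  if (n %| m - 1)%N then misiurewicz_num d m n zeta * gleason_den d n
  else misiurewicz_num d m n zeta.

Definition Zadjoin (zeta x : algC) : Prop :=
  exists q : {poly int}, x = (map_poly intr q).[zeta].

(* Main.v *)
Require Import Defs.
From mathcomp Require Import ring.

(** Put M_k := a_{m-1+k} - zeta a_{m-1}.  For fixed x, the set of k > 0 with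
    M_k(x) = 0 (resp. a_k(x) = 0) is closed under multiples and gcd, so if all
    the M_k (resp. a_k) are separable then M_k is the product over j | k of its
    "primitive parts", and Moebius inversion shows that the product defining G
    is the primitive part of M_n, divided by that of a_n when n | m-1.  In that
    case the latter divides the former because a_{m-1+k}(x) = a_k(x) and
    a_{m-1}(x) = 0 at its roots.

    Separability: a root x of M_k is an algebraic integer, and
    a_i'(x) = 1 mod d for i > 0, so M_k'(x) = 0 would give d | 1 - zeta.  With N
    the order of zeta, N = prod_(0 < i < N) (1 - zeta^i) is then divisible by
    d^(N-1), which forces d = 2 and zeta = -1.  In this last case put
    A := a_{m+k-2}(x) and B := a_{m-2}(x): M_k'(x) = 0 reads A + B = 1 mod 2,
    while M_k(x) = 0 reads A^2 + B^2 + 2x = 0, so that (A + B)^2 = 0 mod 2.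

    Integrality: a quotient of monic polynomials with coefficients in Z[zeta]
    has coefficients in Z[zeta], by Euclidean division in Z[t][c], t |-> zeta. *)

Set Implicit Arguments.
Unset Strict Implicit.
Unset Printing Implicit Defensive.

Import GRing.Theory Num.Theory.
Local Open Scope ring_scope.

(** * Moebius inversion *)

Lemma moebius_mul_prime (p e : nat) : prime p -> (0 < e)%N ->
  moebius (p * e) = if (p %| e)%N then 0 else - moebius e.
Proof.
move=> p_pr e_gt0; have p_gt0 := prime_gt0 p_pr.
rewrite /moebius muln_gt0 p_gt0 e_gt0 /=.
have p_in : p \in primes (p * e) by rewrite mem_primes p_pr muln_gt0 p_gt0 e_gt0 dvdn_mulr.
case: (boolP (p %| e)%N) => [p_e | pNe].
  case: allP => // /(_ p p_in); rewrite lognM // logn_prime // eqxx.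
  by rewrite add1n eqSS -leqn0 leqNgt logn_gt0 mem_primes p_pr e_gt0 p_e.
have pNp : p \notin primes e by rewrite mem_primes p_pr e_gt0.
have prM : perm_eq (primes (p * e)) (p :: primes e).
  apply: uniq_perm => [||q]; rewrite ?primes_uniq //=.
    by rewrite pNp primes_uniq.
  by rewrite primesM // inE primes_prime // inE.
rewrite (perm_size prM) (perm_all _ prM) /= exprS mulN1r.
have -> : logn p (p * e) == 1%N.
  rewrite lognM // logn_prime // eqxx add1n eqSS.
  by rewrite -leqn0 leqNgt logn_gt0.
have -> : all (fun q => logn q (p * e) == 1%N) (primes e)
        = all (fun q => logn q e == 1%N) (primes e).
  apply: eq_in_all => q q_in; rewrite lognM // logn_prime //.
  by case: (eqVneq q p) q_in pNp => [-> -> | _ _ _].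
by rewrite /=; case: ifP; rewrite ?oppr0.
Qed.

(* The divisors e and p e with p not dividing e cancel, p the least prime factor of n. *)
Lemma sum_moebius_divisors (n : nat) : (0 < n)%N ->
  \sum_(e <- divisors n) moebius e = (n == 1%N)%:R.
Proof.
move=> n_gt0; case: eqVneq => [-> | n_neq1]; first by rewrite big_seq1.
have n_gt1 : (1 < n)%N by case: n n_gt0 n_neq1 => [|[]].
set p := pdiv n; have p_pr : prime p := pdiv_prime n_gt1.
have p_gt0 := prime_gt0 p_pr.
have [k defn] : exists k, n = (p * k)%N.
  by have /dvdnP[k ->] := pdiv_dvd n; exists k; rewrite mulnC.
have k_gt0 : (0 < k)%N by move: n_gt0; rewrite defn muln_gt0 => /andP[].
rewrite (bigID (fun e => p %| e)%N) /=.
have -> : \sum_(e <- divisors n | (p %| e)%N) moebius e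
        = \sum_(e <- divisors k) moebius (p * e).
  rewrite -big_filter -(big_map (muln p) xpredT); apply: perm_big.
  apply: uniq_perm; rewrite ?filter_uniq ?divisors_uniq //.
    by rewrite map_inj_uniq ?divisors_uniq // => x y /eqP; rewrite eqn_pmul2l // => /eqP.
  move=> e; rewrite mem_filter -dvdn_divisors //.
  apply/andP/mapP => [[/dvdnP[f ->]] | [f]].
    by rewrite defn mulnC dvdn_pmul2l // => fk; exists f; rewrite -?dvdn_divisors.
  by rewrite -dvdn_divisors // => fk ->; rewrite dvdn_mulr // defn dvdn_pmul2l.
have -> : \sum_(e <- divisors n | ~~ (p %| e)%N) moebius e
        = \sum_(e <- divisors k | ~~ (p %| e)%N) moebius e.
  rewrite -big_filter -[RHS]big_filter; apply: perm_big.
  apply: uniq_perm; rewrite ?filter_uniq ?divisors_uniq // => e.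
  rewrite !mem_filter -!dvdn_divisors //.
  have [//|pNe /=] := boolP (p %| e)%N.
  by rewrite defn Gauss_dvdr // coprime_sym prime_coprime.
rewrite (bigID (fun e => p %| e)%N) /= big_seq_cond big1 => [|e /andP[ek pe]]; last first.
  rewrite moebius_mul_prime ?pe //.
  by move: ek; rewrite -dvdn_divisors // => /dvdn_gt0; apply.
rewrite add0r -big_split /= big_seq_cond big1 // => e /andP[ek /negPf pe].
rewrite moebius_mul_prime ?pe ?addNr //.
by move: ek; rewrite -dvdn_divisors // => /dvdn_gt0; apply.
Qed.

(** The substitution e = n/k turns the multiples k of j dividing n into the divisors e of n/j, which
    reduces this to [sum_moebius_divisors]. *)
Lemma sum_moebius_cofactors (n j : nat) : (0 < n)%N -> (j %| n)%N ->
  \sum_(k <- divisors n | (j %| k)%N) moebius (n %/ k) = (j == n)%:R.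
Proof.
move=> n_gt0 j_n; have j_gt0 := dvdn_gt0 n_gt0 j_n.
have nj_gt0 : (0 < n %/ j)%N by rewrite divn_gt0 // dvdn_leq.
have -> : (j == n) = (n %/ j == 1)%N.
  by rewrite -[RHS](eqn_pmul2l j_gt0) muln1 mulnC divnK // eq_sym.
rewrite -sum_moebius_divisors // -big_filter.
rewrite -(big_map (fun k => n %/ k)%N xpredT); apply: perm_big.
have divK k : (k %| n)%N -> (n %/ (n %/ k) = k)%N by move=> ?; rewrite divnA // mulKn.
apply: uniq_perm; rewrite ?divisors_uniq //.
  rewrite map_inj_in_uniq ?filter_uniq ?divisors_uniq // => k l.
  rewrite !mem_filter -!dvdn_divisors // => /andP[_ kn] /andP[_ ln] eq_kl.
  by rewrite -(divK k) // eq_kl divK.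
move=> e; rewrite -dvdn_divisors //; apply/mapP/idP => [[k] | e_nj].
  rewrite mem_filter -dvdn_divisors // => /andP[/dvdnP[i ->] k_n] ->.
  have i_gt0 : (0 < i)%N by have := dvdn_gt0 n_gt0 k_n; rewrite muln_gt0 => /andP[].
  have /dvdnP[r ->] := k_n.
  rewrite mulnK ?muln_gt0 ?i_gt0 // !mulnA mulnK //.
  by rewrite dvdn_mulr.
have e_n : (e %| n)%N := dvdn_trans e_nj (dvdn_div j_n).
exists (n %/ e)%N; last by rewrite divK.
rewrite mem_filter -dvdn_divisors // dvdn_div // andbT.
by rewrite dvdn_divRL // mulnC -dvdn_divRL.
Qed.

Lemma expfz_sum (F : fieldType) (I : Type) (x : F) (r : seq I) (P : pred I)
    (e : I -> int) : x != 0 ->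
  x ^ (\sum_(i <- r | P i) e i) = \prod_(i <- r | P i) x ^ e i.
Proof.
by move=> x_neq0; apply: (big_morph _ _ (expr0z x)) => a b; rewrite expfzDr.
Qed.

Lemma exprz_prod (F : fieldType) (I : Type) (r : seq I) (P : pred I)
    (f : I -> F) (z : int) :
  (\prod_(i <- r | P i) f i) ^ z = \prod_(i <- r | P i) f i ^ z.
Proof.
by apply: (big_morph (fun x => x ^ z)) => [a b|]; rewrite ?expfzMl ?exp1rz.
Qed.

(** After exchanging the two products, g j carries the exponent computed in [sum_moebius_cofactors]:
    1 for j = n and 0 otherwise. Adding exponents of both signs requires g j to be nonzero. *)
Lemma moebius_inversion_prod (F : fieldType) (n : nat) (f g : nat -> F) :
    (0 < n)%N ->
    {in divisors n, forall j, g j != 0} ->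
    {in divisors n, forall k, f k = \prod_(j <- divisors k) g j} ->
  \prod_(k <- divisors n) f k ^ moebius (n %/ k) = g n.
Proof.
move=> n_gt0 g_neq0 fE.
transitivity (\prod_(k <- divisors n) \prod_(j <- divisors n | (j %| k)%N)
                g j ^ moebius (n %/ k)).
  rewrite big_seq [RHS]big_seq; apply: eq_bigr => k k_n.
  have k_dvd : (k %| n)%N by rewrite dvdn_divisors.
  have k_gt0 := dvdn_gt0 n_gt0 k_dvd.
  rewrite fE // exprz_prod -[RHS]big_filter; apply: perm_big.
  apply: uniq_perm; rewrite ?filter_uniq ?divisors_uniq // => j.
  rewrite mem_filter -!dvdn_divisors //.
  by case: (boolP (j %| k)%N) => // /dvdn_trans ->.
rewrite (exchange_big_dep xpredT) //= big_seq.
have gE j : j \in divisors n ->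
    \prod_(k <- divisors n | (j %| k)%N) g j ^ moebius (n %/ k)
    = if j == n then g j else 1.
  move=> j_n; rewrite -expfz_sum ?g_neq0 // sum_moebius_cofactors ?dvdn_divisors //.
  by case: eqP => _ /=; rewrite ?expr1z ?expr0z.
rewrite (eq_bigr _ gE) -big_seq -big_mkcond /= -big_filter.
rewrite (_ : [seq j <- _ | _] = [:: n]) ?big_seq1 //.
by rewrite filter_pred1_uniq ?divisors_uniq ?divisors_id.
Qed.

(** * Primitive parts of a family of polynomials *)

Section PrimitiveParts.

Variables (F : closedFieldType) (f : nat -> {poly F}).

(** When the indices k > 0 with f k (x) = 0 are closed under gcd, as assumed below, this says for n
    > 0 that n is the least of them. *)
Definition primitive_root_at (n : nat) (x : F) : bool :=
  all (fun k => root (f k) x == (k == n)) (divisors n).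

Definition primitive_roots (n : nat) : seq F :=
  [seq x <- sval (closed_field_poly_normal (f n)) | primitive_root_at n x].

Definition primitive_part (n : nat) : {poly F} :=
  \prod_(x <- primitive_roots n) ('X - x%:P).

Hypothesis f_monic : forall k, (0 < k)%N -> f k \is monic.
Hypothesis f_separable : forall k, (0 < k)%N -> separable_poly (f k).
Hypothesis root_dvdn : forall x k l, (0 < k)%N -> (0 < l)%N -> (k %| l)%N ->
  root (f k) x -> root (f l) x.
Hypothesis root_gcdn : forall x k l, (0 < k)%N -> (0 < l)%N ->
  root (f k) x -> root (f l) x -> root (f (gcdn k l)) x.

Let rts n := sval (closed_field_poly_normal (f n)).

Let f_prod n : (0 < n)%N -> f n = \prod_(x <- rts n) ('X - x%:P).
Proof.
move=> n_gt0; rewrite /rts; case: closed_field_poly_normal => r /= {1}->.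
by rewrite (monicP (f_monic n_gt0)) scale1r.
Qed.

Let mem_rts n x : (0 < n)%N -> (x \in rts n) = root (f n) x.
Proof. by move=> n_gt0; rewrite f_prod // root_prod_XsubC. Qed.

Let uniq_rts n : (0 < n)%N -> uniq (rts n).
Proof. by move=> n_gt0; rewrite -separable_prod_XsubC -f_prod ?f_separable. Qed.

Lemma primitive_root_atP n x : (0 < n)%N ->
  reflect (root (f n) x /\
           (forall k, (k %| n)%N -> root (f k) x -> k = n))
          (primitive_root_at n x).
Proof.
move=> n_gt0; apply: (iffP allP) => [prim | [fn_x min_n] k].
  split=> [|k k_n fk_x]; first by have /eqP-> := prim n (divisors_id n_gt0).
  by have := prim k; rewrite -dvdn_divisors // fk_x [true == _]eq_sym eqb_id => /(_ k_n)/eqP.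
rewrite -dvdn_divisors // => k_n; apply/eqP; apply/idP/eqP => [|->] //.
exact: min_n.
Qed.

Lemma primitive_root_at_root n x : (0 < n)%N -> primitive_root_at n x -> root (f n) x.
Proof. by move=> n_gt0 /primitive_root_atP[]. Qed.

Lemma mem_primitive_roots n x : (0 < n)%N ->
  (x \in primitive_roots n) = primitive_root_at n x.
Proof.
move=> n_gt0; rewrite mem_filter mem_rts //.
by case: (boolP (primitive_root_at n x)) => // /primitive_root_at_root->.
Qed.

Lemma primitive_roots_uniq n : (0 < n)%N -> uniq (primitive_roots n).
Proof. by move=> n_gt0; rewrite filter_uniq ?uniq_rts. Qed.

Lemma primitive_part_monic n : primitive_part n \is monic.
Proof. exact: monic_prod_XsubC. Qed.

Lemma primitive_root_at_inj j k x : (0 < j)%N -> (0 < k)%N ->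
  primitive_root_at j x -> primitive_root_at k x -> j = k.
Proof.
move=> j_gt0 k_gt0 /primitive_root_atP[] // fj min_j /primitive_root_atP[] // fk min_k.
have fg := root_gcdn j_gt0 k_gt0 fj fk.
by rewrite -(min_j _ (dvdn_gcdl j k) fg) (min_k _ (dvdn_gcdr j k) fg).
Qed.

(** The witness is the least j > 0 with f j (x) = 0: gcd(j, k) is again such an index and divides j,
    so it equals j, and j divides k. *)
Lemma primitive_root_at_exists k x : (0 < k)%N -> root (f k) x ->
  exists2 j, (j %| k)%N & primitive_root_at j x.
Proof.
move=> k_gt0 fk.
have ex_j : exists j, (0 < j)%N && root (f j) x by exists k; rewrite k_gt0.
case: (ex_minnP ex_j) => j /andP[j_gt0 fj] min_j.
have min_dvd i : (i %| j)%N -> root (f i) x -> i = j.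
  move=> i_j fi; apply/eqP; rewrite eqn_leq dvdn_leq // min_j // fi.
  by rewrite (dvdn_gt0 j_gt0).
exists j; last by apply/primitive_root_atP.
by rewrite -(min_dvd _ (dvdn_gcdl j k) (root_gcdn j_gt0 k_gt0 fj fk)) dvdn_gcdr.
Qed.

(** By separability all products run over distinct roots, and each root of f k is primitive for
    exactly one j dividing k. *)
Lemma prod_primitive_part k : (0 < k)%N ->
  f k = \prod_(j <- divisors k) primitive_part j.
Proof.
move=> k_gt0; rewrite f_prod //.
transitivity (\prod_(j <- divisors k)
    \prod_(x <- rts k | primitive_root_at j x) ('X - x%:P)); last first.
  rewrite big_seq [RHS]big_seq; apply: eq_bigr => j.
  rewrite -dvdn_divisors // => j_k; have j_gt0 := dvdn_gt0 k_gt0 j_k.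
  rewrite -big_filter; apply: perm_big; apply: uniq_perm.
  - by rewrite filter_uniq ?uniq_rts.
  - exact: primitive_roots_uniq.
  move=> x; rewrite mem_primitive_roots // mem_filter mem_rts //.
  case: (boolP (primitive_root_at j x)) => //= prim_x.
  by rewrite (root_dvdn j_gt0 k_gt0 j_k) ?primitive_root_at_root.
rewrite (exchange_big_dep xpredT) //= big_seq [RHS]big_seq.
apply: eq_bigr => x; rewrite mem_rts // => /(primitive_root_at_exists k_gt0)[j j_k prim_j].
have j_gt0 := dvdn_gt0 k_gt0 j_k.
rewrite big_mkcond (bigD1_seq j) ?divisors_uniq -?dvdn_divisors //= prim_j.
rewrite big_seq_cond big1 ?mulr1 // => i /andP[].
rewrite -dvdn_divisors // => i_k; apply: contraNeq; case: ifP; rewrite ?eqxx // => prim_i _.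
by rewrite (primitive_root_at_inj _ _ prim_i prim_j) ?(dvdn_gt0 k_gt0 i_k).
Qed.

Lemma prod_moebius_primitive_part n : (0 < n)%N ->
  \prod_(k <- divisors n) tofrac (f k) ^ moebius (n %/ k)
  = tofrac (primitive_part n).
Proof.
move=> n_gt0.
apply: (moebius_inversion_prod (f := fun k => tofrac (f k))
          (g := fun k => tofrac (primitive_part k))) => // k k_n.
  by rewrite tofrac_eq0 monic_neq0 ?primitive_part_monic.
rewrite prod_primitive_part ?rmorph_prod //.
by move: k_n; rewrite -dvdn_divisors // => /(dvdn_gt0 n_gt0).
Qed.

End PrimitiveParts.

(** * Monic polynomials with coefficients in the image of a ring morphism *)

Section MonicLifts.

Variables (R : comNzRingType) (K : fieldType) (phi : {rmorphism R -> K}).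

(** Carrying a monic lift, rather than a condition on each coefficient, lets Euclidean division take
    place over [R]. *)
Definition monic_lift (p : {poly K}) : Prop :=
  exists2 p0 : {poly R}, p0 \is monic & map_poly phi p0 = p.

Lemma monic_lift_prod (I : eqType) (r : seq I) (p : I -> {poly K}) :
  {in r, forall i, monic_lift (p i)} -> monic_lift (\prod_(i <- r) p i).
Proof.
move=> lift_p; rewrite big_seq; elim/big_ind: _ => //.
- by exists 1; rewrite ?monic1 ?rmorph1.
- by move=> _ _ [p0 mp0 <-] [q0 mq0 <-]; exists (p0 * q0); rewrite ?monicMl // rmorphM.
Qed.

(** Divide a lift of q p by a monic lift of p; uniqueness of Euclidean division over K identifies
    the image of the quotient with q. *)
Lemma monic_lift_quotient (p q : {poly K}) :
  monic_lift p -> monic_lift (q * p) -> monic_lift q.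
Proof.
case=> p0 mp0 <- [c0 mc0 qpE].
have size_map (r : {poly R}) : r \is monic -> size (map_poly phi r) = size r.
  by move=> mr; rewrite size_map_poly_id0 // (monicP mr) rmorph1 oner_neq0.
have mp : map_poly phi p0 \is monic by apply: monic_map.
have mq : q \is monic by rewrite -(monicMr _ mp) -qpE monic_map.
pose q0 := Pdiv.Ring.rdivp c0 p0; pose r0 := Pdiv.Ring.rmodp c0 p0.
have c0E : c0 = q0 * p0 + r0 := Pdiv.RingMonic.rdivp_eq mp0 c0.
have lt_r0 : (size r0 < size p0)%N by rewrite Pdiv.Ring.ltn_rmodp monic_neq0.
exists q0.
  (* q0 p0 = c0 - r0 keeps the leading coefficient 1 of c0, because size r0 < size p0 <= size c0. *)
  rewrite -(monicMr _ mp0) -[_ * p0](addrK r0) -c0E /monic qualifE /= lead_coefDl.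
    exact: mc0.
  rewrite size_polyN (leq_trans lt_r0) // -(size_map c0) // qpE -(size_map p0) //.
  by rewrite size_proper_mul ?mulf_neq0 ?lead_coef_eq0 ?monic_neq0 //
     -(prednK (_ : 0 < size q)%N) ?addSn ?leq_addl // size_poly_gt0 monic_neq0.
(* Otherwise (q - phi q0) phi(p0) has size at least that of p0, yet it equals phi(r0), which is
   smaller. *)
apply/esym/eqP; rewrite -subr_eq0; apply/negPn/negP => dq_neq0.
have: (q - map_poly phi q0) * map_poly phi p0 = map_poly phi r0.
  by rewrite mulrBl -qpE c0E rmorphD rmorphM /= addrAC subrr add0r.
move/(congr1 (fun r : {poly K} => size r)).
rewrite size_Mmonic //; apply/eqP; rewrite neq_ltn; apply/orP; right.
rewrite (leq_ltn_trans (size_poly _ _)) // (leq_trans lt_r0) // -(size_map p0) //.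
by rewrite -(prednK (_ : 0 < size (q - map_poly phi q0)%R)%N) ?addSn ?leq_addl // size_poly_gt0.
Qed.

End MonicLifts.

(** Strong induction: the primitive part of f n is the quotient of f n by the primitive parts at the
    proper divisors of n. *)
Lemma primitive_part_monic_lift (R : comNzRingType) (F : closedFieldType)
    (phi : {rmorphism R -> F}) (f : nat -> {poly F}) (n : nat) :
    (forall k, (0 < k)%N -> f k = \prod_(j <- divisors k) primitive_part f j) ->
    (forall k, (0 < k)%N -> monic_lift phi (f k)) ->
  (0 < n)%N -> monic_lift phi (primitive_part f n).
Proof.
move=> f_prod lift_f; elim/ltn_ind: n => n IHn n_gt0.
apply: (@monic_lift_quotient _ _ _ (\prod_(j <- divisors n | j != n) primitive_part f j)).
  rewrite -big_filter; apply: monic_lift_prod => j.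
  rewrite mem_filter -dvdn_divisors // => /andP[j_neq j_n].
  by apply: IHn; rewrite ?(dvdn_gt0 n_gt0) // ltn_neqAle j_neq dvdn_leq.
by rewrite -bigD1_seq ?divisors_uniq ?divisors_id // -f_prod //; apply: lift_f.
Qed.

(** * Arithmetic of roots of unity *)

(** w = b/a is a rational algebraic integer, hence an integer. *)
Lemma Aint_natM_dvdn (a b : nat) (w : algC) :
  (0 < a)%N -> w \in Aint -> a%:R * w = b%:R -> (a %| b)%N.
Proof.
move=> a_gt0 wA awE; have a_neq0 : a%:R != 0 :> algC by rewrite pnatr_eq0 -lt0n.
have wE : w = b%:R / a%:R by rewrite -awE mulrAC mulfV ?mul1r.
rewrite -dvdC_nat /dvdC unfold_in (negPf a_neq0) -wE; apply: Cint_rat_Aint => //.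
by rewrite wE rpred_div ?rpred_nat.
Qed.

(** Evaluate (X^N - 1)/(X - 1) at 1, once as a product over roots and once as a geometric sum. *)
Lemma prod_one_sub_prim_root (R : fieldType) (N : nat) (z : R) :
  N.-primitive_root z -> \prod_(1 <= i < N) (1 - z ^+ i) = N%:R.
Proof.
move=> z_prim; have N_gt0 := prim_order_gt0 z_prim.
have: ('X - 1) * \prod_(1 <= i < N) ('X - (z ^+ i)%:P)
      = ('X - 1) * \sum_(i < N) 'X^i.
  transitivity ('X^N - 1 : {poly R}); last exact: subrX1.
  by rewrite -[RHS](factor_Xn_sub_1 z_prim) [RHS]big_ltn //.
have X1_neq0 : 'X - 1 != 0 :> {poly R} by rewrite -polyC1 polyXsubC_eq0.
move/(mulfI X1_neq0)/(congr1 (fun p => p.[1])).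
rewrite horner_prod horner_sum; under eq_bigr do rewrite hornerXsubC.
move=> ->; under eq_bigr do rewrite hornerXn expr1n.
by rewrite sumr_const card_ord.
Qed.

Lemma unity_root_cong1 (d : nat) (z u : algC) : (2 <= d)%N ->
  d.-unity_root z -> z != 1 -> u \in Aint -> 1 - z = d%:R * u ->
  d = 2%N /\ z = -1.
Proof.
move=> d_ge2 z_unity z_neq1 uA zE; have d_gt0 : (0 < d)%N by apply: ltnW.
have zA : z \in Aint := Aint_unity_root d_gt0 z_unity.
have [N z_prim N_d] := prim_order_exists d_gt0 (unity_rootP z_unity).
have N_gt1 : (1 < N)%N.
  case: N z_prim {N_d} => [/prim_order_gt0 // | [/prim_expr_order|//]].
  by rewrite expr1 => /eqP; rewrite (negPf z_neq1).
have dvdN : (d ^ N.-1 %| N)%N.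
  (* v i is (1 - z^i)/(1 - z), so each factor 1 - z^i equals d u (v i). *)
  pose v i := \sum_(j < i) z ^+ j.
  apply: (@Aint_natM_dvdn _ _ (\prod_(1 <= i < N) (u * v i))).
  - by rewrite expn_gt0 d_gt0.
  - by apply: rpred_prod => i _; rewrite rpredM // rpred_sum // => j _; rewrite rpredX.
  rewrite -(prod_one_sub_prim_root z_prim) natrX -subn1 -prodr_const_nat -big_split.
  apply: eq_bigr => i _ /=; rewrite mulrA -zE -opprB mulNr -subrX1 opprB.
  by [].
(* N divides d as well, so d^(N-1) <= N <= d. *)
have N2 : N = 2%N.
  have le_dN : (d ^ N.-1 <= d ^ 1)%N.
    by rewrite expn1 (leq_trans (dvdn_leq _ dvdN)) ?(ltnW N_gt1) // dvdn_leq.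
  by move: le_dN; rewrite leq_exp2l //; case: N N_gt1 {z_prim N_d dvdN} => [|[|[]]].
have z_eqN1 : z = -1.
  have /eqP := prim_expr_order z_prim; rewrite N2 sqrf_eq1 (negPf z_neq1).
  by move/eqP.
(* With z = -1 the hypothesis reads 2 = d u, so d divides 2. *)
split=> //; apply/eqP; rewrite eqn_leq d_ge2 andbT dvdn_leq //.
by apply: (@Aint_natM_dvdn _ _ u) => //; rewrite -zE z_eqN1 opprK.
Qed.

(** * The critical orbit *)

(** The power has degree d^(i+1) >= 2, so adding X leaves its leading term alone. The index starts
    at 1 because a_0 = 0. *)
Lemma crit_orbit_size_monic (d i : nat) : (2 <= d)%N ->
  size (crit_orbit d i.+1) = (d ^ i).+1 /\ crit_orbit d i.+1 \is monic.
Proof.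
move=> d_ge2; elim: i => [|i [IHs IHm]].
  have -> : crit_orbit d 1 = 'X.
    by rewrite /crit_orbit /= /unicritical expr0n; case: d d_ge2 => // d _; rewrite add0r.
  by rewrite size_polyX monicX.
have sX : size (crit_orbit d i.+1 ^+ d) = (d ^ i.+1).+1.
  rewrite -[LHS]prednK ?size_poly_gt0 ?expf_neq0 ?monic_neq0 //.
  by rewrite size_exp IHs /= expnSr.
have lt_sX : (size ('X : {poly int}) < size (crit_orbit d i.+1 ^+ d)%R)%N.
  by rewrite sX size_polyX ltnS (leq_trans d_ge2) // -{1}(expn1 d) leq_exp2l.
rewrite /crit_orbit iterS -/(crit_orbit d i.+1) /unicritical.
by rewrite size_polyDl // sX monicE lead_coefDl // -monicE monic_exp.
Qed.

Lemma crit_orbit_monic (d i : nat) :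
  (2 <= d)%N -> (0 < i)%N -> crit_orbit d i \is monic.
Proof. by case: i => // i d_ge2 _; have [] := crit_orbit_size_monic i d_ge2. Qed.

Lemma ltn_size_crit_orbit (d i j : nat) : (2 <= d)%N ->
  (i < j)%N -> (size (crit_orbit d i) < size (crit_orbit d j))%N.
Proof.
move=> d_ge2; case: j => // j lt_ij.
have [-> _] := crit_orbit_size_monic j d_ge2.
case: i lt_ij => [_|i lt_ij]; first by rewrite size_poly0.
have [-> _] := crit_orbit_size_monic i d_ge2.
by rewrite ltnS ltn_exp2l.
Qed.

Lemma size_crit_orbitC (d i : nat) : size (crit_orbitC d i) = size (crit_orbit d i).
Proof. by apply: size_map_inj_poly => //; apply: intr_inj. Qed.

Lemma monic_subZ (R : nzRingType) (c : R) (p q : {poly R}) :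
  p \is monic -> (size q < size p)%N -> p - c *: q \is monic.
Proof.
move=> p_monic lt_qp; rewrite monicE lead_coefDl // size_polyN.
exact: leq_ltn_trans (size_scale_leq _ _) lt_qp.
Qed.

Lemma crit_orbitC_monic (d i : nat) :
  (2 <= d)%N -> (0 < i)%N -> crit_orbitC d i \is monic.
Proof. by move=> d_ge2 i_gt0; rewrite monic_map ?crit_orbit_monic. Qed.

(* Indexed by s = m - 1. *)
Definition misiurewicz (d s : nat) (zeta : algC) (k : nat) : {poly algC} :=
  crit_orbitC d (s + k) - zeta *: crit_orbitC d s.

Section Orbit.

Variables (d : nat) (x : algC).

Local Notation b i := (crit_orbitC d i).[x].
Local Notation b' i := (crit_orbitC d i)^`().[x].

Lemma crit_orbitC0 : crit_orbitC d 0 = 0.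
Proof. exact: rmorph0. Qed.

Lemma crit_orbitCS i : crit_orbitC d i.+1 = crit_orbitC d i ^+ d + 'X.
Proof. by rewrite /crit_orbitC /= rmorphD rmorphXn /= map_polyX. Qed.

Lemma crit_orbit_valS i : b i.+1 = b i ^+ d + x.
Proof. by rewrite crit_orbitCS !hornerE. Qed.

(** The factor d is pulled out so that, at an algebraic integer x, this reads as a congruence to 1
    mod d. *)
Lemma crit_orbit_derivS i : b' i.+1 = 1 + d%:R * (b i ^+ d.-1 * b' i).
Proof.
rewrite crit_orbitCS derivD derivX deriv_exp hornerD hornerMn hornerM horner_exp hornerC addrC.
by rewrite mulr_natl [b' i * _]mulrC.
Qed.

Lemma crit_orbit_val_shift i j t : b i = b j -> b (i + t) = b (j + t).
Proof.
by move=> eq_ij; elim: t => [|t IHt]; rewrite ?addn0 // !addnS !crit_orbit_valS IHt.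
Qed.

Lemma crit_orbit_val_period s k t q : b (s + k) = b s ->
  b (s + t + q * k) = b (s + t).
Proof.
move=> per_k; elim: q => [|q IHq]; first by rewrite addn0.
have -> : (s + t + q.+1 * k = s + k + (t + q * k))%N.
  by rewrite mulSn addnCA !addnA; congr addn; rewrite addnAC addnC addnA.
by rewrite (crit_orbit_val_shift _ per_k) addnA.
Qed.

(** Bezout in the form kk k = kl l + gcd(k, l): from s + gcd(k, l), adding kl periods l reaches s +
    kk k, which is kk periods k past s. *)
Lemma crit_orbit_val_gcdn s k l : (0 < k)%N ->
  b (s + k) = b s -> b (s + l) = b s -> b (s + gcdn k l) = b s.
Proof.
move=> k_gt0 per_k per_l; have [kk kl kE _] := egcdnP l k_gt0.
rewrite -(crit_orbit_val_period _ kl per_l) -addnA [(gcdn _ _ + _)%N]addnC -kE.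
by have := crit_orbit_val_period 0 kk per_k; rewrite addn0.
Qed.

(** Periodicity is assumed only from s+1 on, since b_(s+k) is to be zeta b_s rather than b_s. As k >
    0, the index s + k already lies in the periodic range. *)
Lemma crit_orbit_val_dvdn s k l : (0 < k)%N -> (0 < l)%N -> (k %| l)%N ->
  b (s.+1 + k) = b s.+1 -> b (s + l) = b (s + k).
Proof.
move=> k_gt0 l_gt0 /dvdnP[[|q] lE] per_k; first by rewrite lE in l_gt0.
have skE : (s + k = s.+1 + k.-1)%N by rewrite addSnnS prednK.
by rewrite lE mulSn addnA skE crit_orbit_val_period.
Qed.

Lemma root_crit_orbitC_dvdn k l :
  (0 < k)%N -> (0 < l)%N -> (k %| l)%N ->
  root (crit_orbitC d k) x -> root (crit_orbitC d l) x.
Proof.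
rewrite !rootE => k_gt0 l_gt0 /dvdnP[q ->] /eqP bk.
have b0 : b 0 = 0 by rewrite crit_orbitC0 horner0.
have per_k : b (0 + k) = b 0 by rewrite b0.
by have := crit_orbit_val_period 0 q per_k; rewrite b0 !add0n => ->.
Qed.

Lemma root_crit_orbitC_gcdn k l :
  (0 < k)%N -> (0 < l)%N ->
  root (crit_orbitC d k) x -> root (crit_orbitC d l) x ->
  root (crit_orbitC d (gcdn k l)) x.
Proof.
rewrite !rootE => k_gt0 _ /eqP bk /eqP bl.
have b0 : b 0 = 0 by rewrite crit_orbitC0 horner0.
by have := @crit_orbit_val_gcdn 0 _ l k_gt0; rewrite !add0n b0 => ->.
Qed.

Section Misiurewicz.

Variables (s : nat) (zeta : algC).
Hypothesis zeta_unity : d.-unity_root zeta.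

Lemma root_misiurewiczE k :
  root (misiurewicz d s zeta k) x = (b (s + k) == zeta * b s).
Proof. by rewrite rootE !hornerE subr_eq0. Qed.

(** Raising to the power d removes zeta. *)
Lemma misiurewicz_period k :
  b (s + k) = zeta * b s -> b (s.+1 + k) = b s.+1.
Proof.
move=> bsk; rewrite addSn !crit_orbit_valS bsk exprMn.
by rewrite (unity_rootP zeta_unity) mul1r.
Qed.

Lemma root_misiurewicz_dvdn k l :
  (0 < k)%N -> (0 < l)%N -> (k %| l)%N ->
  root (misiurewicz d s zeta k) x -> root (misiurewicz d s zeta l) x.
Proof.
rewrite !root_misiurewiczE => k_gt0 l_gt0 k_l /eqP bk; rewrite -bk; apply/eqP.
by apply: crit_orbit_val_dvdn => //; apply: misiurewicz_period.
Qed.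

(** The orbit has period gcd(k, l) from s+1 on; as this divides k, b_(s+gcd(k, l)) equals
    b_(s+k). *)
Lemma root_misiurewicz_gcdn k l :
  (0 < k)%N -> (0 < l)%N ->
  root (misiurewicz d s zeta k) x -> root (misiurewicz d s zeta l) x ->
  root (misiurewicz d s zeta (gcdn k l)) x.
Proof.
rewrite !root_misiurewiczE => k_gt0 l_gt0 /eqP bk /eqP bl; rewrite -bk; apply/eqP/esym.
apply: crit_orbit_val_dvdn; rewrite ?gcdn_gt0 ?k_gt0 ?dvdn_gcdl //.
by apply: crit_orbit_val_gcdn => //; apply: misiurewicz_period.
Qed.

End Misiurewicz.

Lemma monic_intr_Aint (p : {poly int}) :
  p \is monic -> root (map_poly intr p) x -> x \in Aint.
Proof.
move=> p_monic px; apply: root_monic_Aint px _ _; first exact: monic_map.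
by apply/polyOverP => i; rewrite coef_map /= rpred_int.
Qed.

Section Integral.

Hypothesis xA : x \in Aint.

Lemma crit_orbit_val_Aint i : b i \in Aint.
Proof.
elim: i => [|i IHi]; first by rewrite crit_orbitC0 horner0 rpred0.
by rewrite crit_orbit_valS rpredD ?rpredX.
Qed.

Lemma crit_orbit_deriv_Aint i : b' i \in Aint.
Proof.
elim: i => [|i IHi]; first by rewrite crit_orbitC0 deriv0 horner0 rpred0.
by rewrite crit_orbit_derivS rpredD ?rpred1 // !rpredM ?rpredX ?rpred_nat ?crit_orbit_val_Aint.
Qed.

End Integral.

End Orbit.

(** * Separability *)

(** A common root with the derivative would make -1 a multiple of d in the algebraic integers. *)
Lemma crit_orbitC_separable (d k : nat) :
  (2 <= d)%N -> (0 < k)%N -> separable_poly (crit_orbitC d k).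
Proof.
move=> d_ge2 k_gt0; rewrite unlock; apply/Pdiv.ClosedField.coprimepP => x bk.
have xA : x \in Aint := monic_intr_Aint (crit_orbit_monic d_ge2 k_gt0) bk.
case: k k_gt0 {bk} => // k _; rewrite crit_orbit_derivS.
set w := _ * _.[x]; have wA : w \in Aint.
  by rewrite rpredM ?rpredX ?crit_orbit_val_Aint ?crit_orbit_deriv_Aint.
apply/eqP => /eqP; rewrite addrC addr_eq0 => /eqP dw.
suff: (d %| 1)%N by rewrite dvdn1 => /eqP d1; rewrite d1 in d_ge2.
apply: (@Aint_natM_dvdn _ _ (- w)); rewrite ?rpredN ?(ltnW d_ge2) //.
by rewrite mulrN dw opprK.
Qed.

Lemma misiurewicz_monic (d s k : nat) (zeta : algC) : (2 <= d)%N -> (0 < k)%N ->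
  misiurewicz d s zeta k \is monic.
Proof.
move=> d_ge2 k_gt0; apply: monic_subZ.
  by rewrite crit_orbitC_monic // addn_gt0 k_gt0 orbT.
rewrite !size_crit_orbitC ltn_size_crit_orbit //.
by rewrite -{1}(addn0 s) ltn_add2l.
Qed.

(** A root of M_k is also a root of a_(s+1+k) - a_(s+1), which is monic over the integers. *)
Lemma root_misiurewicz_Aint (d s k : nat) (zeta x : algC) :
  (2 <= d)%N -> d.-unity_root zeta -> (0 < k)%N ->
  root (misiurewicz d s zeta k) x -> x \in Aint.
Proof.
move=> d_ge2 zeta_unity k_gt0; rewrite root_misiurewiczE => /eqP bk.
have per := misiurewicz_period zeta_unity bk.
apply: (@monic_intr_Aint _ (crit_orbit d (s.+1 + k) - 1 *: crit_orbit d s.+1)).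
  apply: monic_subZ; first exact: crit_orbit_monic.
  by rewrite ltn_size_crit_orbit // -{1}(addn0 s.+1) ltn_add2l.
by rewrite scale1r rmorphB rootE !hornerE subr_eq0; apply/eqP.
Qed.

Lemma misiurewicz_separable (d s k : nat) (zeta : algC) :
  (2 <= d)%N -> (0 < s)%N -> (0 < k)%N ->
  d.-unity_root zeta -> zeta != 1 -> separable_poly (misiurewicz d s zeta k).
Proof.
move=> d_ge2 s_gt0 k_gt0 zeta_unity zeta_neq1; have d_gt0 := ltnW d_ge2.
rewrite unlock; apply/Pdiv.ClosedField.coprimepP => x Mx.
have xA := root_misiurewicz_Aint d_ge2 zeta_unity k_gt0 Mx.
have zA : zeta \in Aint := Aint_unity_root d_gt0 zeta_unity.
have bA i : (crit_orbitC d i).[x] \in Aint by apply: crit_orbit_val_Aint.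
have b'A i : (crit_orbitC d i)^`().[x] \in Aint by apply: crit_orbit_deriv_Aint.
move: Mx; rewrite root_misiurewiczE; case: s s_gt0 => // s _.
rewrite addSn derivB derivZ hornerD hornerN hornerZ !crit_orbit_derivS !crit_orbit_valS.
set A := (crit_orbitC d (s + k)).[x]; set B := (crit_orbitC d s).[x].
set A' := _^`().[x]; set B' := _^`().[x] => /eqP root_x.
apply/eqP => deriv0.
have zE : 1 - zeta = d%:R * (zeta * (B ^+ d.-1 * B') - A ^+ d.-1 * A').
  by apply/eqP; rewrite -subr_eq0 -deriv0; apply/eqP; ring.
have [d2 zN1] : d = 2%N /\ zeta = -1.
  by apply: unity_root_cong1 zE => //; rewrite rpredB // !rpredM ?rpredX ?bA ?b'A.
rewrite {}zN1 {}d2 /= in A A' B B' bA b'A root_x deriv0 zE *.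
(* For d = 2, a_i a_i' is congruent to a_i mod 2: a_i' is 1 mod 2 for i > 0, and a_0 = 0. *)
have bb'E i : exists2 v, v \in Aint &
    (crit_orbitC 2 i).[x] * (crit_orbitC 2 i)^`().[x] = (crit_orbitC 2 i).[x] + 2 * v.
  case: i => [|i]; first by exists 0; rewrite ?rpred0 // crit_orbitC0 horner0 !(mul0r, mulr0) addr0.
  exists ((crit_orbitC 2 i.+1).[x] * ((crit_orbitC 2 i).[x] * (crit_orbitC 2 i)^`().[x])).
    by rewrite !rpredM.
  by rewrite crit_orbit_derivS /=; ring.
have [v vA AE] := bb'E (s + k)%N; have [w wA BE] := bb'E s.
rewrite -/A -/A' -/B -/B' in AE BE.
(* Halving M_k'(x) = 0 gives 1 + (A + 2v) + (B + 2w) = 0, that is A + B = 2t - 1. *)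
pose t := - (v + w).
have tA : t \in Aint by rewrite rpredN rpredD.
suff: (2 %| 1)%N by [].
(* Since A^2 + B^2 = -2x, expanding (A + B)^2 = (2t - 1)^2 gives 2AB = 4t^2 - 4t + 1 + 2x; so twice
   this witness is 1. *)
apply: (@Aint_natM_dvdn _ _ (A * B - x - 2 * t ^+ 2 + 2 * t)) => //.
  by rewrite !(rpredD, rpredN, rpredM, rpredX) ?bA ?rpred_nat.
have ABE : A + B = 2 * t - 1.
  have two_neq0 : 2 != 0 :> algC by rewrite pnatr_eq0.
  apply: (mulfI two_neq0); apply/eqP; rewrite -subr_eq0 -deriv0; apply/eqP.
  by rewrite !expr1 AE BE /t; ring.
have -> : B = 2 * t - 1 - A by rewrite -ABE addrAC subrr add0r.
have: A ^+ 2 + x + (B ^+ 2 + x) = 0 by rewrite root_x mulN1r addNr.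
have -> : B = 2 * t - 1 - A by rewrite -ABE addrAC subrr add0r.
move=> q0; apply/eqP; rewrite -subr_eq0 -oppr_eq0 -q0; apply/eqP; ring.
Qed.

(** * Integrality *)

(** The morphism t |-> zeta on Z[t], whose image is Z[zeta]. *)
Definition eval_at (zeta : algC) : {rmorphism {poly int} -> algC} :=
  horner_eval zeta \o map_poly intr.

Lemma eval_atC (zeta : algC) (c : int) : eval_at zeta c%:P = c%:~R.
Proof. by rewrite /= map_polyC /horner_eval /= hornerC. Qed.

Lemma map_eval_at_polyC (zeta : algC) (p : {poly int}) :
  map_poly (eval_at zeta) (map_poly polyC p) = map_poly intr p.
Proof. by rewrite -map_poly_comp; apply: eq_map_poly => c; apply: eval_atC. Qed.

Lemma crit_orbitC_monic_lift (d k : nat) (zeta : algC) :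
  (2 <= d)%N -> (0 < k)%N -> monic_lift (eval_at zeta) (crit_orbitC d k).
Proof.
move=> d_ge2 k_gt0; exists (map_poly polyC (crit_orbit d k)).
  by rewrite monic_map ?crit_orbit_monic.
exact: map_eval_at_polyC.
Qed.

Lemma misiurewicz_monic_lift (d s k : nat) (zeta : algC) :
  (2 <= d)%N -> (0 < k)%N -> monic_lift (eval_at zeta) (misiurewicz d s zeta k).
Proof.
move=> d_ge2 k_gt0.
(* The scalar 'X is the variable t lifting zeta, not the parameter c. *)
exists (map_poly polyC (crit_orbit d (s + k)) - 'X *: map_poly polyC (crit_orbit d s)).
  apply: monic_subZ; first by rewrite monic_map ?crit_orbit_monic ?addn_gt0 ?k_gt0 ?orbT.
  rewrite !size_map_polyC ltn_size_crit_orbit //.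
  by rewrite -{1}(addn0 s) ltn_add2l.
rewrite rmorphB /= map_polyZ !map_eval_at_polyC.
by rewrite /= map_polyX /horner_eval hornerX.
Qed.

(** As n divides s, a_s(x) = 0 and the orbit restarts at index s; hence M_k(x) = a_k(x) for every
    k. *)
Lemma primitive_root_at_misiurewicz (d s n : nat) (zeta x : algC) :
  (0 < n)%N -> (n %| s)%N ->
  primitive_root_at (crit_orbitC d) n x ->
  primitive_root_at (misiurewicz d s zeta) n x.
Proof.
move=> n_gt0 n_s /primitive_root_atP[] // bn min_n.
have bs : (crit_orbitC d s).[x] = 0.
  case: s n_s => [|s] n_s; first by rewrite crit_orbitC0 horner0.
  by apply/eqP; apply: root_crit_orbitC_dvdn bn.
have bsk k : (crit_orbitC d (s + k)).[x] = (crit_orbitC d k).[x].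
  by apply: (@crit_orbit_val_shift _ _ _ 0); rewrite bs crit_orbitC0 horner0.
apply/primitive_root_atP => //; split=> [|k k_n].
  by rewrite root_misiurewiczE bsk bs mulr0.
by rewrite root_misiurewiczE bsk bs mulr0; apply: min_n.
Qed.

(** * G as a quotient of primitive parts *)

Lemma gleason_denE (d n : nat) :
  gleason_den d n =
  (\prod_(k <- divisors n) tofrac (crit_orbitC d k) ^ moebius (n %/ k))^-1.
Proof. by rewrite -prodfV; apply: eq_bigr => k _; rewrite invr_expz. Qed.

Lemma misiurewicz_numE (d s n : nat) (zeta : algC) :
  misiurewicz_num d s.+1 n zeta =
  \prod_(k <- divisors n) tofrac (misiurewicz d s zeta k) ^ moebius (n %/ k).
Proof. by apply: eq_bigr => k _; rewrite addSn !subn1. Qed.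

Theorem theorem2p1 (d m n : nat) (zeta : algC)
    (hd : (2 <= d)%N) (hm : (2 <= m)%N) (hn : (1 <= n)%N)
    (hzeta : d.-unity_root zeta) (hzeta1 : zeta != 1) :
  exists P : {poly algC},
    [/\ Gfun d m n zeta = tofrac P,
        P \is monic,
        forall i : nat, Zadjoin zeta P`_i &
        forall x : algC, root P x -> mup x P = 1%N].
Proof.
(* It suffices to list the roots without repetition: simplicity follows from [uniq], and the
   coefficients are read off the lift. *)
suff [r [GE r_uniq [p0 _ p0E]]] : exists r : seq algC,
    [/\ Gfun d m n zeta = tofrac (\prod_(x <- r) ('X - x%:P)), uniq r
      & monic_lift (eval_at zeta) (\prod_(x <- r) ('X - x%:P))].
  exists (\prod_(x <- r) ('X - x%:P)); split=> [||i|x].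
  - exact: GE.
  - exact: monic_prod_XsubC.
  - by exists p0`_i; rewrite -p0E coef_map.
  - by rewrite root_prod_XsubC mu_prod_XsubC count_uniq_mem // => ->.
case: m hm => // s s_gt0; rewrite ltnS in s_gt0.
pose M := misiurewicz d s zeta; pose a := crit_orbitC d.
have M_monic k : (0 < k)%N -> M k \is monic by apply: misiurewicz_monic.
have M_sep k : (0 < k)%N -> separable_poly (M k).
  by move=> k_gt0; apply: misiurewicz_separable.
have M_dvd x := @root_misiurewicz_dvdn d x s zeta hzeta.
have M_gcd x := @root_misiurewicz_gcdn d x s zeta hzeta.
have a_monic k : (0 < k)%N -> a k \is monic by apply: crit_orbitC_monic.
have a_sep k : (0 < k)%N -> separable_poly (a k) by apply: crit_orbitC_separable.
have a_dvd x := @root_crit_orbitC_dvdn d x.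
have a_gcd x := @root_crit_orbitC_gcdn d x.
have M_lift : monic_lift (eval_at zeta) (primitive_part M n).
  apply: primitive_part_monic_lift => // k k_gt0.
    exact: (prod_primitive_part M_monic M_sep M_dvd M_gcd).
  exact: misiurewicz_monic_lift.
have a_lift : monic_lift (eval_at zeta) (primitive_part a n).
  apply: primitive_part_monic_lift => // k k_gt0.
    exact: (prod_primitive_part a_monic a_sep a_dvd a_gcd).
  exact: crit_orbitC_monic_lift.
have M_uniq : uniq (primitive_roots M n) by apply: primitive_roots_uniq.
have numE : misiurewicz_num d s.+1 n zeta = tofrac (primitive_part M n).
  by rewrite misiurewicz_numE (prod_moebius_primitive_part M_monic M_sep M_dvd M_gcd).
rewrite /Gfun subn1 /=; case: ifP => [n_s | _]; last first.
  by exists (primitive_roots M n).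
(* When n divides s, dividing by the primitive part of a_n removes exactly its roots, all of which
   are primitive for M_n. *)
pose r := [seq x <- primitive_roots M n | ~~ primitive_root_at a n x].
have ME : primitive_part M n = \prod_(x <- r) ('X - x%:P) * primitive_part a n.
  rewrite mulrC {1}/primitive_part (bigID (primitive_root_at a n)) /=.
  rewrite -[X in X * _]big_filter -[X in _ * X]big_filter.
  congr (_ * _); apply: perm_big; apply: uniq_perm => [||x].
  - exact: filter_uniq.
  - exact: primitive_roots_uniq.
  rewrite mem_filter !mem_primitive_roots //.
  case: (boolP (primitive_root_at a n x)) => //.
  exact: primitive_root_at_misiurewicz.
exists r; split; last 2 first.
- by rewrite filter_uniq.
- by apply: monic_lift_quotient a_lift _; rewrite -ME.
rewrite numE gleason_denE (prod_moebius_primitive_part a_monic a_sep a_dvd a_gcd) //.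
by rewrite ME tofracM mulfK // tofrac_eq0 monic_neq0 ?primitive_part_monic.
Qed.
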